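(* Let $n\geq2$, $m\geq1$ be integers and $p\in(0,1)$. Put $\delta=2p-1$, let $\pi\sim\nu^{(p)}_{n,m}$ and $D_n^{\leftarrow}:=\operatorname{des}(\pi^{-1})$. Then $$\mathbb{E}[D_n^{\leftarrow}]=\frac{n-1}{2}-\frac{\delta(n-1)}{2m},$$ and $$\operatorname{Var}(D_n^{\leftarrow})=\frac{n+1}{12}+\frac{n-2}{6m^2}-\frac{\delta^2(n-1)}{4m^2}.$$ In particular, for $p=1/2$, $$\mathbb{E}[D_n^{\leftarrow}]=\frac{n-1}{2},\qquad\operatorname{Var}(D_n^{\leftarrow})=\frac{n+1}{12}+\frac{n-2}{6m^2}.$$
   Context: Asymmetric shelf shuffle: let $m\ge 1$ be an integer, $p\in(0,1)$, $q=1-p$. A deck of $n$ cards labelled $1,\ldots,n$ from top to bottom is dealt sequentially from the bottom (card $n$ first, card $1$ last). Each card is assigned to one of $m$ labelled shelves independently and uniformly at random, and is placed at the top of the existing pile on that shelf with probability $p$ and at the bottom with probability $q$, independently of everything else. The shuffled deck is formed by joining the piles in shelf order (shelf $1$ on top, then shelf $2$, and so on). The resulting random permutation is $\pi=(\pi_1,\ldots,\pi_n)\in S_n$, where $\pi_i$ is the label of the card in position $i$ from the top, and $\nu^{(p)}_{n,m}$ denotes its law on $S_n$. $\operatorname{des}(\sigma)=|\{i\in\{1,\ldots,n-1\}:\sigma_i>\sigma_{i+1}\}|$ is the number of descents of $\sigma\in S_n$. *)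

(* Defs.v *)
From HB Require Import structures.
From mathcomp Require Import all_boot all_order all_algebra all_fingroup.
From mathcomp Require Import all_classical all_reals all_analysis.
Set Implicit Arguments.
Unset Strict Implicit.
Unset Printing Implicit Defensive.

Import Order.TTheory GRing.Theory Num.Theory.

(* Cards and positions 1, ..., n and shelves 1, ..., m are represented by
   'I_n and 'I_m, i.e. shifted to start from 0.  Piles and decks are sequences
   of cards listed from top to bottom. *)

Section ShelfShuffle.
Variables n m : nat.

(* (w c).1 is the shelf of card c; (w c).2 = true when c is put on top of the
   pile of that shelf, and false when it is put at the bottom. *)
Definition assignment := {ffun 'I_n -> 'I_m * bool}.

Definition place (w : assignment) (piles : {ffun 'I_m -> seq 'I_n})
    (c : 'I_n) : {ffun 'I_m -> seq 'I_n} :=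
  [ffun j => if j == (w c).1 then
               if (w c).2 then c :: piles j else rcons (piles j) c
             else piles j].

Definition deal (w : assignment) : {ffun 'I_m -> seq 'I_n} :=
  foldl (place w) [ffun=> [::]] (rev (enum 'I_n)).

Definition deck (w : assignment) : seq 'I_n :=
  flatten [seq deal w j | j <- enum 'I_m].

Lemma count_flatten_place (a : pred 'I_n) w piles c :
  count a (flatten [seq place w piles c j | j <- enum 'I_m]) =
  a c + count a (flatten [seq piles j | j <- enum 'I_m]).
Proof.
rewrite !count_flatten -!map_comp !sumnE !big_map /=.
rewrite (bigD1 (w c).1) //= [in RHS](bigD1 (w c).1) //= addnA.
congr addn; last first.
  by apply: eq_bigr => j /negbTE jN; rewrite ffunE jN.
by rewrite ffunE eqxx; case: ifP => _ //=; rewrite -cats1 count_cat /= addn0 addnC.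
Qed.

Lemma deck_perm_eq w : perm_eq (deck w) (enum 'I_n).
Proof.
apply/seq.permP => a; rewrite /deck /deal -[in RHS](count_rev a).
rewrite -[RHS]addn0.
have <- : count a (flatten [seq [ffun=> [::]] j | j <- enum 'I_m]) = 0.
  by elim: (enum 'I_m) => //= j s IH; rewrite ffunE.
move: [ffun=> [::]]; elim: (rev _) => [|c s IH] piles //=.
by rewrite IH count_flatten_place; rewrite addnCA addnA.
Qed.

Lemma deck_size w : size (deck w) == n.
Proof. by rewrite (perm_size (deck_perm_eq w)) size_enum_ord. Qed.

Definition deck_tuple (w : assignment) : n.-tuple 'I_n := Tuple (deck_size w).

Lemma deck_tuple_inj w : injective (tnth (deck_tuple w)).
Proof.
by apply/tuple_uniqP; rewrite (perm_uniq (deck_perm_eq w)) enum_uniq.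
Qed.

(* Maps a position to the label of the card in that position. *)
Definition shuffled (w : assignment) : 'S_n := perm (@deck_tuple_inj w).

Local Open Scope ring_scope.

Definition assignment_mass (R : realType) (p : R) (w : assignment) : R :=
  \prod_(c < n) (m%:R^-1 * (if (w c).2 then p else 1 - p)).

(* The probability mass function on 'S_n of the shuffled deck. *)
Definition shelf_law (R : realType) (p : R) (s : 'S_n) : R :=
  \sum_(w : assignment | shuffled w == s) assignment_mass p w.

Lemma shelf_law_ge0 (R : realType) (p : R) (s : 'S_n) :
  0 < p < 1 -> 0 <= shelf_law p s.
Proof.
case/andP=> p0 p1; apply: sumr_ge0 => w _; apply: prodr_ge0 => c _.
by rewrite mulr_ge0 ?invr_ge0//; case: ifP => _; rewrite ?subr_ge0 ltW.
Qed.

Lemma shelf_law_sum1 (R : realType) (p : R) :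
  (0 < m)%N -> \sum_(s : 'S_n) shelf_law p s = 1.
Proof.
move=> m0.
have -> : \sum_(s : 'S_n) shelf_law p s = \sum_(w : assignment) assignment_mass p w.
  by rewrite [RHS](partition_big shuffled xpredT).
rewrite /assignment_mass.
rewrite -(bigA_distr_bigA
  (fun (_ : 'I_n) (x : 'I_m * bool) => m%:R^-1 * (if x.2 then p else 1 - p))).
apply: big1 => c _.
rewrite -(pair_bigA _ (fun (_ : 'I_m) b => m%:R^-1 * (if b then p else 1 - p))) /=.
under eq_bigr => j _ do rewrite big_bool /= -mulrDr addrC subrK mulr1.
by rewrite sumr_const card_ord -[_ *+ m]mulr_natr mulVf// pnatr_eq0 -lt0n.
Qed.

End ShelfShuffle.

Definition des (n : nat) (s : 'S_n) : nat :=
  #|[set i : 'I_n | [exists j : 'I_n, (j == i.+1 :> nat) && (s j < s i)%N]]|.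

(* Main.v *)
Require Import Defs.
From HB Require Import structures.
From mathcomp Require Import all_boot all_order all_algebra all_fingroup.
From mathcomp Require Import all_classical all_reals all_analysis.
From mathcomp Require Import ring zify.

(** Call a card's draw the pair (shelf, side) it receives.  Card [i] is dealt
right after card [i+1], so when both go to the same shelf, card [i] ends up
above or below card [i+1] according to whether it is put on top or at the
bottom; when they go to different shelves, the shelves decide.  Hence [i] is a
descent of the inverse permutation exactly when the draws of [i] and [i+1]
satisfy [inverts] ([des_shuffledV]), and the number of descents is a sum of
[n - 1] indicators, each a fixed function of two consecutive independent
draws.

Such a sum is one-dependent: its mean is [n - 1] times the mean of one
indicator, and its variance is [n - 1] times the variance of one indicator
plus [2 (n - 2)] times the covariance of two neighbours
([pmean_chain_sum], [pmean_chain_sum_sq]).  Independence is used in the form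
of [pmean_resample]: replacing one draw by a fresh one preserves expectations.

It remains to evaluate the constants.  With [delta = 2p - 1], the mean is
[theta = 1/2 - delta/(2m)] and the variance of an indicator is [theta (1 -
theta)].  For the covariance, condition on the shared draw, on shelf [j]: once
the side of that draw is averaged out, the conditional means of the two
indicators are affine in [j] with slopes [-1/m] and [1/m], and both have mean
[theta], so the covariance is minus the variance of a uniform point of [{0,
..., m-1}] divided by [m^2], that is [(1/m^2 - 1)/12], whatever [p] is
([inverts_cov]). *)

Set Implicit Arguments.
Unset Strict Implicit.
Unset Printing Implicit Defensive.
Import Order.TTheory GRing.Theory Num.Theory.
Local Open Scope ring_scope.

(** * Descents in terms of the draws *)

Section Descents.
Variables n m : nat.
Implicit Types (w : assignment n m) (c : 'I_n).

(** Of two cards on the same shelf, the one with the smaller label is dealt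
last, so its side alone decides which of the two lies above the other. *)
Definition before w : rel 'I_n := fun c c' =>
  ((w c).1 < (w c').1)%N ||
  ((w c).1 == (w c').1) && (if (c < c')%N then (w c).2 else ~~ (w c').2).

(** Dealing is studied on an arbitrary increasing list [s] of cards because the
induction adds cards one by one: the card dealt last is smaller than all the
cards already in the piles, and goes to an extremity of its pile. *)
Lemma deal_before w (s : seq 'I_n) (j : 'I_m) :
  pairwise (fun c c' => (c < c')%N) s ->
  let pile := foldl (place w) [ffun=> [::]] (rev s) j in
  [/\ {subset pile <= s}, {in pile, forall c, (w c).1 = j}
    & pairwise (before w) pile].
Proof.
elim: s => [|c s IH] /=; first by rewrite ffunE.
case/andP=> /allP c_lt /IH[sub onj pw]; rewrite rev_cons foldl_rcons ffunE.
case: eqP => [jE|_]; last first.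
  by split=> // x /sub; rewrite inE orbC => ->.
case: ifP => ct; split=> [x|x|].
- by rewrite !inE => /orP[->//|/sub ->]; rewrite orbT.
- by rewrite inE => /orP[/eqP->|/onj].
- rewrite /= pw andbT; apply/allP => x xp.
  by rewrite /before (onj _ xp) jE eqxx c_lt ?sub// ct orbT.
- by rewrite mem_rcons !inE => /orP[->//|/sub ->]; rewrite orbT.
- by rewrite mem_rcons inE => /orP[/eqP->|/onj].
- rewrite pairwise_rcons pw andbT; apply/allP => x xp.
  have cx := c_lt _ (sub _ xp).
  by rewrite /before (onj _ xp) jE eqxx (ltnNge x) (ltnW cx) /= ct orbT.
Qed.

Lemma pairwise_flatten_map (A B : eqType) (lt : rel A) (r : rel B)
    (f : A -> seq B) (s : seq A) :
  pairwise lt s -> (forall i, pairwise r (f i)) ->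
  (forall i j x y, lt i j -> x \in f i -> y \in f j -> r x y) ->
  pairwise r (flatten [seq f i | i <- s]).
Proof.
move=> + pwf ltr; elim: s => //= i s IH /andP[/allP i_lt /IH pws].
rewrite pairwise_cat pwf pws !andbT; apply/allrelP => x y xi.
by case/flatten_mapP => j js yj; apply: ltr (i_lt _ js) xi yj.
Qed.

Lemma pairwise_ltn_enum k : pairwise (fun i j : 'I_k => (i < j)%N) (enum 'I_k).
Proof.
rewrite -(pairwise_map val ltn) val_enum_ord -sorted_pairwise ?iota_ltn_sorted//.
exact: ltn_trans.
Qed.

Lemma deck_before w : pairwise (before w) (deck w).
Proof.
have dealP j := deal_before w j (pairwise_ltn_enum n).
apply: pairwise_flatten_map (pairwise_ltn_enum m) _ _ => [j|i j x y ij xi yj].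
  by have [] := dealP j.
have [_ oni _] := dealP i; have [_ onj _] := dealP j.
by rewrite /before (oni _ xi) (onj _ yj) ij.
Qed.

Lemma shuffled_before w c c' :
  ((shuffled w)^-1%g c < (shuffled w)^-1%g c')%N -> before w c c'.
Proof.
set u := _ c; set u' := _ c' => uu'.
have val_nth i : shuffled w i = nth c (deck w) i by rewrite permE (tnth_nth c).
have /(pairwiseP c)/(_ u u') := deck_before w.
rewrite !inE (eqP (deck_size w)) -!val_nth !permKV.
exact.
Qed.

(** [inverts a b] tells whether draws [a], [b] of two cards, the first of
smaller label, place the first card below the second. *)
Definition inverts (a b : 'I_m * bool) : bool :=
  (b.1 < a.1)%N || (b.1 == a.1) && ~~ a.2.

(** The relation [before] is total on distinct cards, so the order of the
positions of [c] and [c'] is determined by their draws. *)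
Lemma shuffled_inverts w c c' : (c < c')%N ->
  ((shuffled w)^-1%g c' < (shuffled w)^-1%g c)%N = inverts (w c) (w c').
Proof.
move=> cc'; apply/idP/idP => [/shuffled_before|].
  by rewrite /before /inverts (ltnNge c' c) (ltnW cc').
apply: contraTT; rewrite -leqNgt leq_eqVlt => /orP[/eqP/val_inj/perm_inj cE|].
  by rewrite cE ltnn in cc'.
move/shuffled_before; rewrite /before /inverts cc'.
case: (ltngtP (w c).1 (w c').1) => [lt|gt|/val_inj ->] /=.
- by rewrite -val_eqE/= gtn_eqF.
- by rewrite -val_eqE/= gtn_eqF.
- by rewrite eqxx negbK.
Qed.

End Descents.

Lemma des_sum n (s : 'S_n.+1) :
  des s = (\sum_(i < n) (s (lift ord0 i) < s (widen_ord (leqnSn n) i)))%N.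
Proof.
rewrite /des cardsE -sum1_card big_mkcond big_ord_recr /= [X in (_ + X)%N]ifF.
  rewrite addn0; apply: eq_bigr => i _; rewrite unfold_in /=.
  case: (boolP (s _ < _)%N) => [lt|nlt].
    by rewrite ifT//; apply/existsP; exists (lift ord0 i); rewrite lift0 eqxx.
  rewrite ifF//; apply/existsP => -[j /andP[/eqP jE]].
  by rewrite (_ : j = lift ord0 i) ?(negbTE nlt)//; apply: val_inj; rewrite /= jE.
by apply/existsP => -[j /andP[/eqP jE _]]; have := ltn_ord j; rewrite jE ltnn.
Qed.

Lemma des_shuffledV n m (w : assignment n.+1 m) :
  des (shuffled w)^-1%g =
  (\sum_(i < n) inverts (w (widen_ord (leqnSn n) i)) (w (lift ord0 i)))%N.
Proof.
by rewrite des_sum; apply: eq_bigr => i _; rewrite shuffled_inverts ?lift0.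
Qed.

(** * Expectations over independent draws *)

Section ProductMean.
Variables (R : comNzRingType) (I A : finType) (mu : A -> R).
Hypothesis mu1 : \sum_a mu a = 1.
Implicit Types (w : {ffun I -> A}) (i j k : I).

(** Expectation of [F w] when the coordinates of [w] are independent, each with
mass function [mu]. *)
Definition pmean (F : {ffun I -> A} -> R) : R :=
  \sum_(w : {ffun I -> A}) (\prod_i mu (w i)) * F w.

Definition upd w i a : {ffun I -> A} := [ffun k => if k == i then a else w k].

Lemma updE w i a k : upd w i a k = if k == i then a else w k.
Proof. by rewrite ffunE. Qed.

Lemma eq_pmean F G : F =1 G -> pmean F = pmean G.
Proof. by move=> FG; apply: eq_bigr => w _; rewrite FG. Qed.

Lemma pmean_sum (J : finType) (F : J -> {ffun I -> A} -> R) :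
  pmean (fun w => \sum_j F j w) = \sum_j pmean (F j).
Proof.
by rewrite exchange_big; apply: eq_bigr => w _; rewrite mulr_sumr.
Qed.

Lemma pmeanZ a F : pmean (fun w => a * F w) = a * pmean F.
Proof. by rewrite mulr_sumr; apply: eq_bigr => w _; rewrite mulrCA. Qed.

Lemma pmean1 : pmean (fun=> 1) = 1.
Proof.
rewrite /pmean; under eq_bigr do rewrite mulr1.
by rewrite -(bigA_distr_bigA (fun=> mu)) big1.
Qed.

(** Exchanging the coordinate [i] of [w] with an independent draw [a] is a
measure-preserving involution of the pairs [(w, a)]. *)
Lemma pmean_resample i F :
  pmean F = pmean (fun w => \sum_a mu a * F (upd w i a)).
Proof.
have swapK : involutive
    (fun x : {ffun I -> A} * A => (upd x.1 i x.2, x.1 i)).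
  move=> [w a]; rewrite updE eqxx; congr pair; apply/ffunP => k.
  by rewrite !updE; case: eqP => // ->.
rewrite /pmean; under [RHS]eq_bigr do rewrite mulr_sumr.
rewrite pair_bigA (reindex_inj (inv_inj swapK)) /=.
rewrite -(pair_bigA _ (fun w a => (\prod_k mu (upd w i a k)) *
  (mu (w i) * F (upd (upd w i a) i (w i))))) /=.
apply: eq_bigr => w _; rewrite -[LHS]mul1r -mu1 mulr_suml.
apply: eq_bigr => a _.
have -> : upd (upd w i a) i (w i) = w.
  by apply/ffunP => k; rewrite !updE; case: eqP => // ->.
rewrite (bigD1 i) //= [in RHS](bigD1 i) //= updE eqxx.
rewrite [in RHS](eq_bigr (fun k => mu (w k))); last first.
  by move=> k /negbTE kN; rewrite updE kN.
ring.
Qed.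

(** The function [G] may depend on all coordinates except [i] and [j], which
makes it independent of [g (w i) (w j)]. *)
Lemma pmean_pair i j (g : A -> A -> R) (G : {ffun I -> A} -> R) : i != j ->
  (forall w a, G (upd w i a) = G w) -> (forall w a, G (upd w j a) = G w) ->
  pmean (fun w => g (w i) (w j) * G w) =
  (\sum_a mu a * \sum_b mu b * g a b) * pmean G.
Proof.
move=> /negbTE ij Gi Gj; rewrite (pmean_resample j) (pmean_resample i) -pmeanZ.
apply: eq_pmean => w; rewrite mulr_suml; apply: eq_bigr => a _.
rewrite -mulrA mulr_suml; congr (_ * _); apply: eq_bigr => b _.
by rewrite Gj Gi !updE ij !eqxx mulrA.
Qed.

(** The two factors share the coordinate [j] only: they are independent
conditionally on it. *)
Lemma pmean_path i j k (g h : A -> A -> R) : i != j -> i != k -> j != k ->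
  pmean (fun w => g (w i) (w j) * h (w j) (w k)) =
  \sum_b mu b * ((\sum_a mu a * g a b) * (\sum_c mu c * h b c)).
Proof.
move=> /negbTE ij /negbTE ik /negbTE jk; rewrite -[RHS]mulr1 -pmean1 -pmeanZ.
rewrite (pmean_resample i) (pmean_resample k) (pmean_resample j).
apply: eq_pmean => w; rewrite mulr1; apply: eq_bigr => b _; congr (_ * _).
rewrite mulrC mulr_suml; apply: eq_bigr => c _; rewrite -mulrA; congr (_ * _).
rewrite mulrC mulr_suml; apply: eq_bigr => a _.
by rewrite !updE !(eq_sym k) (eq_sym j) ij ik jk !eqxx; ring.
Qed.

End ProductMean.

(** The covariance matrix of a stationary one-dependent sequence is
tridiagonal; this is the sum of its entries. *)
Lemma sum_band (R : comPzRingType) (v c : R) n :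
  \sum_(i < n.+1) \sum_(j < n.+1)
     (if i == j :> nat then v
      else if (i.+1 == j) || (j.+1 == i) then c else 0) =
  v *+ n.+1 + c *+ n.*2.
Proof.
elim: n => [|n IH].
  by rewrite big_ord1 big_ord1 eqxx addr0.
have band k : (k = n)%N -> \sum_(i < k.+1) (if (i == n.+1 :> nat) then v
      else if (i.+1 == n.+1)%N || (n.+2 == i) then c else 0) = c.
  move=> ->; rewrite big_ord_recr /= big1 ?add0r ?eqxx ?(ltn_eqF (ltnSn n))//.
  by move=> i _; have ik := ltn_ord i; rewrite !ifF//=; lia.
rewrite big_ord_recr /=; under eq_bigr do rewrite big_ord_recr /=.
rewrite big_split /= IH band// big_ord_recr /= eqxx.
under [X in X + v]eq_bigr do rewrite eq_sym orbC.
by rewrite band// doubleS !mulrS; ring.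
Qed.

Section Chain.
Variables (R : comNzRingType) (A : finType) (mu : A -> R) (n : nat).
Hypothesis mu1 : \sum_a mu a = 1.
Variable g : A -> A -> R.

Let lo (i : 'I_n) : 'I_n.+1 := widen_ord (leqnSn n) i.
Let hi (i : 'I_n) : 'I_n.+1 := lift ord0 i.

Definition chain_sum (w : {ffun 'I_n.+1 -> A}) : R :=
  \sum_(i < n) g (w (lo i)) (w (hi i)).

Let lo_hi i : lo i != hi i.
Proof. by rewrite -val_eqE /= ltn_eqF. Qed.

Lemma pmean_chain_sum :
  pmean mu chain_sum = (\sum_a mu a * \sum_b mu b * g a b) *+ n.
Proof.
rewrite pmean_sum (eq_bigr (fun=> (\sum_a mu a * \sum_b mu b * g a b))).
  by rewrite sumr_const card_ord.
move=> i _; rewrite -[RHS]mulr1 -(pmean1 'I_n.+1 mu1).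
rewrite -(pmean_pair mu1 g (lo_hi i))//.
by apply: eq_pmean => w; rewrite mulr1.
Qed.

(** With a centered [g], terms at distance at least 2 use disjoint
coordinates and are uncorrelated; only the diagonal and the two adjacent
diagonals of the double sum remain. *)
Lemma pmean_chain_sum_sq : (0 < n)%N ->
  \sum_a mu a * \sum_b mu b * g a b = 0 ->
  pmean mu (fun w => chain_sum w ^+ 2) =
  (\sum_a mu a * \sum_b mu b * g a b ^+ 2) *+ n
  + (\sum_b mu b * ((\sum_a mu a * g a b) * (\sum_c mu c * g b c)))
    *+ (n.-1).*2.
Proof.
move=> n0 g0.
set v := \sum_a mu a * \sum_b mu b * g a b ^+ 2.
set c := \sum_b mu b * _.
transitivity (\sum_(i < n) \sum_(j < n)
    pmean mu (fun w => g (w (lo i)) (w (hi i)) * g (w (lo j)) (w (hi j)))).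
  under [RHS]eq_bigr do rewrite -pmean_sum.
  rewrite -pmean_sum; apply: eq_pmean => w; rewrite expr2 mulr_suml.
  by apply: eq_bigr => i _; rewrite mulr_sumr.
have far (i j : 'I_n) : (i.+1 < j)%N ->
  pmean mu (fun w => g (w (lo i)) (w (hi i)) * g (w (lo j)) (w (hi j))) = 0.
  by move=> ij; rewrite (pmean_pair mu1 g (lo_hi i)) ?g0 ?mul0r// => w a;
    rewrite !updE -!val_eqE /= /bump /= !ifF//=; lia.
have near (i j : 'I_n) : (i.+1 = j)%N ->
  pmean mu (fun w => g (w (lo i)) (w (hi i)) * g (w (lo j)) (w (hi j))) = c.
  move=> ij; have jE : lo j = hi i by apply: val_inj; rewrite /= -ij.
  rewrite jE; apply: pmean_path => //; first by rewrite -val_eqE /= /bump; lia.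
  by rewrite -jE.
rewrite -[in RHS](prednK n0) -(sum_band v c n.-1) (prednK n0).
apply: eq_bigr => i _; apply: eq_bigr => j _.
case: (ltngtP i j) => [ij|ji|/val_inj ->].
- case: (ltngtP i.+1 j) => [ij1|ji1|ij1]; last 1 first.
  + exact: near.
  + by rewrite far// gtn_eqF//; lia.
  + by lia.
- under eq_pmean do rewrite mulrC.
  case: (ltngtP j.+1 i) => [ij1|ji1|ij1]; last 1 first.
  + by rewrite near// orbT.
  + by rewrite far// orbF gtn_eqF//; lia.
  + by lia.
- rewrite /v -[RHS]mulr1 -(pmean1 'I_n.+1 mu1).
  rewrite -(pmean_pair mu1 (fun a b => g a b ^+ 2) (lo_hi j))//.
  by apply: eq_pmean => w; rewrite mulr1 expr2.
Qed.

End Chain.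

(** * Moments for the shelf shuffle *)

Lemma sum_ord (R : comPzRingType) m :
  2 * \sum_(j < m) (j%:R : R) = m%:R * (m%:R - 1).
Proof.
elim: m => [|m IH]; first by rewrite big_ord0 mulr0 mul0r.
by rewrite big_ord_recr /= mulrDr IH -natr1; ring.
Qed.

Lemma sum_sqr_dev (R : comPzRingType) (x : R) m :
  6 * \sum_(j < m) (j%:R - x) ^+ 2 =
  m%:R * ((m%:R - 1) * (2 * m%:R - 1) - 6 * x * (m%:R - 1) + 6 * x ^+ 2).
Proof.
elim: m => [|m IH]; first by rewrite big_ord0 mulr0 mul0r.
by rewrite big_ord_recr /= mulrDr IH -natr1; ring.
Qed.

Section CardMoments.
Variables (R : realFieldType) (m : nat) (p : R).
Hypothesis m0 : (0 < m)%N.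

Definition card_mass (a : 'I_m * bool) : R :=
  m%:R^-1 * (if a.2 then p else 1 - p).

Let g (a b : 'I_m * bool) : R := (inverts a b)%:R.

Let M0 : m%:R != 0 :> R. Proof. by rewrite pnatr_eq0 -lt0n. Qed.

(** The shelf is uniform and the side independent of it. *)
Lemma sum_card_mass (F : 'I_m * bool -> R) :
  \sum_a card_mass a * F a =
  m%:R^-1 * \sum_j (p * F (j, true) + (1 - p) * F (j, false)).
Proof.
rewrite (eq_bigr (fun a => card_mass (a.1, a.2) * F (a.1, a.2))) => [|[]//].
rewrite -(pair_bigA _ (fun j b => card_mass (j, b) * F (j, b))) mulr_sumr.
by apply: eq_bigr => j _; rewrite big_bool /card_mass /=; ring.
Qed.

Lemma card_mass1 : \sum_a card_mass a = 1.
Proof.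
transitivity (\sum_a card_mass a * 1); first by under [RHS]eq_bigr do rewrite mulr1.
rewrite sum_card_mass (eq_bigr (fun=> 1)) => [|j _]; last by ring.
by rewrite sumr_const card_ord mulVf.
Qed.

Lemma sum_ord_lt (k : 'I_m) : \sum_(j < m) ((j < k)%N)%:R = k%:R :> R.
Proof.
have count l : (\sum_(j < l) (j < k) = minn l k)%N.
  by elim: l => [|l IH]; rewrite ?big_ord0 ?min0n// big_ord_recr /= IH; lia.
by rewrite -natr_sum count (minn_idPr (ltnW (ltn_ord k))).
Qed.

(** The card is inverted with the next one when the next one goes
to a strictly smaller shelf, or to the same one if [a] is put at the bottom. *)
Lemma inverts_row a :
  \sum_b card_mass b * g a b = m%:R^-1 * (a.1%:R + (~~ a.2)%:R).
Proof.
rewrite sum_card_mass; congr (_ * _).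
transitivity (\sum_(k < m) (((k < a.1)%N)%:R + ((k == a.1) && ~~ a.2)%:R : R)).
  apply: eq_bigr => k _; rewrite /g /inverts /= -mulrDl addrC subrK mul1r.
  by rewrite -val_eqE; case: ltngtP => //=; rewrite ?addr0 ?add0r.
rewrite big_split sum_ord_lt /= (bigD1 a.1) //= eqxx big1 ?addr0//.
by move=> k /negbTE ->.
Qed.

Lemma inverts_col b :
  \sum_a card_mass a * g a b = m%:R^-1 * (m%:R - 1 - b.1%:R + (1 - p)).
Proof.
rewrite sum_card_mass; congr (_ * _).
transitivity (\sum_(j < m) (1 - ((j < b.1)%N)%:R - p * (j == b.1)%:R : R)).
  apply: eq_bigr => k _; rewrite /g /inverts /= -!val_eqE /=.
  by case: (ltngtP k b.1) => /= _; ring.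
rewrite !sumrB sum_ord_lt sumr_const card_ord -mulr_sumr (bigD1 b.1) //= eqxx.
by rewrite big1 ?addr0 => [|k /negbTE ->//] /=; ring.
Qed.

Definition inverts_mean : R := \sum_a card_mass a * \sum_b card_mass b * g a b.

Lemma inverts_meanE : inverts_mean = 1 / 2 - (2 * p - 1) / (2 * m%:R).
Proof.
rewrite /inverts_mean; under eq_bigr do rewrite inverts_row.
rewrite sum_card_mass /= (eq_bigr (fun j : 'I_m => m%:R^-1 * (j%:R + (1 - p)))).
  rewrite -mulr_sumr big_split sumr_const card_ord /= -mulr_natl.
  have -> : \sum_(i < m) (i%:R : R) = m%:R * (m%:R - 1) / 2.
    by rewrite -sum_ord mulrAC divff ?mul1r// pnatr_eq0.
  by field.
by move=> j _; ring.
Qed.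

Let h (a b : 'I_m * bool) : R := g a b - inverts_mean.

Lemma mean_centered (X : 'I_m * bool -> R) :
  \sum_a card_mass a * (X a - inverts_mean) =
  (\sum_a card_mass a * X a) - inverts_mean.
Proof.
under eq_bigr do rewrite mulrBr.
by rewrite sumrB -mulr_suml card_mass1 mul1r.
Qed.

Lemma inverts_centered : \sum_a card_mass a * \sum_b card_mass b * h a b = 0.
Proof.
under eq_bigr do rewrite mean_centered.
by rewrite mean_centered subrr.
Qed.

(** An indicator equals its square. *)
Lemma inverts_var :
  \sum_a card_mass a * \sum_b card_mass b * h a b ^+ 2 =
  inverts_mean * (1 - inverts_mean).
Proof.
have sq a b : h a b ^+ 2 =
    (1 - 2 * inverts_mean) * g a b + inverts_mean ^+ 2.
  by rewrite /h /g; case: inverts => /=; ring.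
have lin (X : 'I_m * bool -> R) u v :
    \sum_a card_mass a * (u * X a + v) = u * (\sum_a card_mass a * X a) + v.
  under eq_bigr do rewrite mulrDr mulrCA.
  by rewrite big_split -mulr_sumr -mulr_suml card_mass1 mul1r.
under eq_bigr do under eq_bigr do rewrite sq.
under eq_bigr do rewrite lin.
by rewrite lin -/inverts_mean; ring.
Qed.

(** Given the shared draw [b], on shelf [j], the centered conditional means are
[-(j - (m-1)/2)/m] and, after averaging over the side of [b],
[(j - (m-1)/2)/m]: the side probability cancels out. *)
Lemma inverts_cov :
  \sum_b card_mass b *
    ((\sum_a card_mass a * h a b) * (\sum_c card_mass c * h b c)) =
  (m%:R ^- 2 - 1) / 12.
Proof.
under eq_bigr do rewrite !mean_centered inverts_col inverts_row.
rewrite sum_card_mass /=.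
rewrite (eq_bigr (fun j : 'I_m =>
    - m%:R ^- 2 * (j%:R - (m%:R - 1) / 2) ^+ 2)) => [|j _].
  rewrite -mulr_sumr.
  have -> (x : R) : \sum_(j < m) (j%:R - x) ^+ 2 =
      m%:R * ((m%:R - 1) * (2 * m%:R - 1) - 6 * x * (m%:R - 1) + 6 * x ^+ 2) / 6.
    by rewrite -sum_sqr_dev mulrAC divff ?mul1r// pnatr_eq0.
  by field.
by rewrite inverts_meanE /=; field.
Qed.

Lemma des_mean n : 
  pmean card_mass (fun w : assignment n.+1 m => (des (shuffled w)^-1%g)%:R) =
  inverts_mean *+ n.
Proof.
rewrite -(pmean_chain_sum n card_mass1 g); apply: eq_pmean => w.
by rewrite des_shuffledV natr_sum.
Qed.

Lemma des_var n : (0 < n)%N ->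
  pmean card_mass (fun w : assignment n.+1 m =>
    ((des (shuffled w)^-1%g)%:R - inverts_mean *+ n) ^+ 2) =
  (inverts_mean * (1 - inverts_mean)) *+ n + ((m%:R ^- 2 - 1) / 12) *+ (n.-1).*2.
Proof.
move=> n0; rewrite -inverts_var -inverts_cov.
rewrite -(pmean_chain_sum_sq card_mass1 n0 inverts_centered).
apply: eq_pmean => w; congr (_ ^+ 2).
by rewrite des_shuffledV natr_sum /chain_sum sumrB sumr_const card_ord.
Qed.

End CardMoments.

(** * Transfer to the random permutation *)

(** The domain splits into the finitely many level sets of [X], on each of
which the integrand is constant. *)
Lemma expectation_finite_valued (R : realType) (d : measure_display)
    (T : measurableType d) (P : probability T R) (S : finType) (X : T -> S)
    (f : S -> R) :
  (forall s, measurable [set t | X t = s]%classic) ->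
  ('E_P[f \o X] = \sum_s (f s)%:E * P [set t | X t = s]%classic)%E.
Proof.
move=> mX; rewrite unlock.
have cover : [set: T]%classic =
    (\big[setU/set0]_(s <- enum S) [set t | X t = s])%classic.
  apply/esym/seteqP; split => // t _; rewrite -bigcup_seq; exists (X t) => //=.
  by rewrite mem_enum.
rewrite cover (integral_bigsetU_EFin P) ?enum_uniq //.
- rewrite big_enum /=; apply: eq_bigr => s _.
  by rewrite -(integral_cst P (mX s)); apply: eq_integral => t; rewrite inE /= => ->.
- by move=> s s' _ _ [t [/= <- <-]].
- move: cover => <- _ Y mY; rewrite setTI.
  have -> : ((EFin \o (f \o X)) @^-1` Y =
      \bigcup_(s in [set s | Y (f s)%:E]) [set t | X t = s])%classic.
    apply/seteqP; split => t; first by exists (X t).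
    by case=> s /= Ys Xs; rewrite /preimage /= Xs.
  by apply: fin_bigcup_measurable => // s _.
Qed.

Lemma expectation_shuffle (R : realType) (n m : nat) (p : R)
    (d : measure_display) (T : measurableType d) (P : probability T R)
    (pi : T -> 'S_n) (f : 'S_n -> R) :
  (forall s : 'S_n, measurable [set t | pi t = s]%classic) ->
  (forall s : 'S_n, P [set t | pi t = s]%classic = (shelf_law m p s)%:E) ->
  ('E_P[f \o pi] =
    (pmean (card_mass p) (fun w : assignment n m => f (shuffled w)))%:E)%E.
Proof.
move=> pi_meas pi_law; rewrite expectation_finite_valued//.
under eq_bigr do rewrite pi_law -EFinM.
rewrite sumEFin; congr EFin.
rewrite /pmean [RHS](partition_big (@shuffled n m) xpredT)//=.
apply: eq_bigr => s _; rewrite mulr_sumr; apply: eq_bigr => w /eqP <-.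
by rewrite mulrC.
Qed.

Theorem corollary2p20 (R : realType) (n m : nat) (hn : (2 <= n)%N)
    (hm : (1 <= m)%N) (p : R) (hp : 0 < p < 1)
    (d : measure_display) (T : measurableType d) (P : probability T R)
    (pi : T -> 'S_n)
    (pi_meas : forall s : 'S_n, measurable [set t | pi t = s]%classic)
    (pi_law : forall s : 'S_n,
      P [set t | pi t = s]%classic = (shelf_law m p s)%:E) :
  let delta : R := 2 * p - 1 in
  let D : T -> R := fun t => (des (pi t)^-1%g)%:R in
  [/\ ('E_P[D] = ((n%:R - 1) / 2 - delta * (n%:R - 1) / (2 * m%:R))%:E)%E,
      ('V_P[D] = ((n%:R + 1) / 12 + (n%:R - 2) / (6 * m%:R ^+ 2)
                  - delta ^+ 2 * (n%:R - 1) / (4 * m%:R ^+ 2))%:E)%E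
    & p = 1 / 2 ->
      ('E_P[D] = ((n%:R - 1) / 2)%:E)%E /\
      ('V_P[D] = ((n%:R + 1) / 12 + (n%:R - 2) / (6 * m%:R ^+ 2))%:E)%E].
Proof.
case: n hn pi pi_meas pi_law => [//|n] n1 pi pi_meas pi_law delta D.
have m0 : m%:R != 0 :> R by rewrite pnatr_eq0 -lt0n.
have law f := expectation_shuffle f pi_meas pi_law.
have ED : ('E_P[D] = (inverts_mean m p *+ n)%:E)%E.
  by rewrite (law (fun s => (des s^-1%g)%:R)) des_mean.
have VD : ('V_P[D] = ((inverts_mean m p * (1 - inverts_mean m p)) *+ n
    + ((m%:R ^- 2 - 1) / 12) *+ (n.-1).*2)%:E)%E.
  rewrite /variance covariance.unlock ED /= -des_var//.
  by rewrite -(law (fun s => ((des s^-1%g)%:R - inverts_mean m p *+ n) ^+ 2)).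
have predn : (n.-1)%:R = n%:R - 1 :> R by rewrite -[in RHS](prednK n1) -natr1 addrK.
have mean : ('E_P[D] =
    ((n.+1%:R - 1) / 2 - delta * (n.+1%:R - 1) / (2 * m%:R))%:E)%E.
  rewrite ED; congr EFin.
  by rewrite inverts_meanE// -mulr_natr -natr1 /delta; field.
have var : ('V_P[D] = ((n.+1%:R + 1) / 12 + (n.+1%:R - 2) / (6 * m%:R ^+ 2)
    - delta ^+ 2 * (n.+1%:R - 1) / (4 * m%:R ^+ 2))%:E)%E.
  rewrite VD; congr EFin.
  rewrite inverts_meanE// -mulr_natr -[X in _ + X]mulr_natr -mul2n natrM predn.
  by rewrite -natr1 /delta; field.
split=> // p2; have delta0 : delta = 0 by rewrite /delta p2; field.
by rewrite mean var delta0 expr0n /= !mul0r !subr0.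
Qed.
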